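(* Let $(R,\mathfrak m)$ be a finite commutative local ring with identity $1\neq 0$, with $|R|=r$ and $|\mathfrak m|=m$. Consider the conditions $$(i)\ \ r=2m,\qquad (ii)\ \ r\ge\left(\tfrac m2+1\right)^2\ \text{ and }\ m\neq 2.$$ Then: (a) If $r$ is odd, $\{G_R,G_R^+\}$ are equienergetic non-isospectral graphs, and they are both Ramanujan if and only if $r$ and $m$ satisfy $(ii)$. (b) $\{G_R,\bar G_R\}$ are equienergetic non-isospectral graphs if and only if $r=m^2$, where $\bar G_R$ is Ramanujan. The graph $G_R$ is Ramanujan provided that $r$ and $m$ satisfy $(i)$ or $(ii)$.
   Context: $G_R$ is the graph with vertex set $R$ in which $v,w$ are adjacent iff $w-v\in R^*$ (the group of units of $R$); $G_R^+$ is the graph with vertex set $R$ in which $v,w$ are adjacent iff $v+w\in R^*$ (with a loop at $x$ when $x+x\in R^*$); $\bar G_R$ is the (loopless) complement of $G_R$. All are regular (a loop contributes $1$ to the degree). Eigenvalues are those of the adjacency matrix (a loop gives a diagonal entry $1$). The energy is the sum of the absolute values of the eigenvalues with multiplicity. Two graphs with the same number of vertices are equienergetic if they have the same energy, isospectral if they have the same eigenvalues with multiplicities. A $k$-regular graph is Ramanujan if every eigenvalue $\lambda$ with $|\lambda|\neq k$ satisfies $|\lambda|\le 2\sqrt{k-1}$ (connectedness is not required). *)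

(* Defs.v *)
From HB Require Import structures.
From mathcomp Require Import all_boot all_order all_algebra all_field.

Set Implicit Arguments.
Unset Strict Implicit.
Unset Printing Implicit Defensive.

Import GRing.Theory Num.Theory.

Local Open Scope ring_scope.

(* [idealr_closed] includes [1 \notin I], so the ideals below are proper. *)
Definition maximal_ideal (R : finComUnitRingType) (I : {set R}) : Prop :=
  idealr_closed I /\
  forall J : {set R}, idealr_closed J -> I \subset J -> J = I.

Definition local_ring (R : finComUnitRingType) (M : {set R}) : Prop :=
  maximal_ideal M /\ forall I : {set R}, maximal_ideal I -> I = M.

(* A graph on a finite vertex type is a symmetric relation; [e v v] is a loop
   at [v], which contributes 1 to the degree and a diagonal entry 1. *)

Definition adjacency_mx (T : finType) (e : rel T) : 'M[algC]_#|T| :=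
  \matrix_(i, j) (e (enum_val i) (enum_val j))%:R.

(* The roots of the characteristic polynomial, listed with multiplicity. *)
Definition spectrum (T : finType) (e : rel T) : seq algC :=
  sval (closed_field_poly_normal (char_poly (adjacency_mx e))).

Definition energy (T : finType) (e : rel T) : algC :=
  \sum_(x <- spectrum e) `|x|.

Definition equienergetic (T T' : finType) (e : rel T) (e' : rel T') : Prop :=
  #|T| = #|T'| /\ energy e = energy e'.

Definition isospectral (T T' : finType) (e : rel T) (e' : rel T') : Prop :=
  #|T| = #|T'| /\ perm_eq (spectrum e) (spectrum e').

Definition regular (T : finType) (k : nat) (e : rel T) : Prop :=
  forall v : T, #|[set w | e v w]| = k.

(* For [k = 0] the adjacency matrix is 0, so every eigenvalue has modulus [k]
   and the value of the square root of [-1] is never used. *)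
Definition ramanujan (T : finType) (e : rel T) : Prop :=
  exists2 k : nat, regular k e &
    forall x : algC, x \in spectrum e -> `|x| != k%:R ->
      `|x| <= 2 * sqrtC (k%:R - 1).

Definition unitary_graph (R : finComUnitRingType) : rel R :=
  fun v w => w - v \is a GRing.unit.

Definition unitary_sum_graph (R : finComUnitRingType) : rel R :=
  fun v w => v + w \is a GRing.unit.

Definition complement_graph (T : finType) (e : rel T) : rel T :=
  fun v w => (v != w) && ~~ e v w.

Definition cond_i (r m : nat) : Prop := r = (2 * m)%N.

Definition cond_ii (r m : nat) : Prop :=
  ((m%:R / 2 + 1) ^+ 2 <= r%:R :> rat) /\ m <> 2%N.

(* Main.v *)
Require Import Defs.
From HB Require Import structures.
From mathcomp Require Import all_boot all_order all_algebra all_field.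
From mathcomp Require Import ring lra zify.

(** A nonunit of a finite local ring is an element of the maximal ideal [M], so
    adjacency in the unitary graphs only depends on cosets of [M].  Put
    [n = #|R|], [m = #|M|], let [J] be the all-ones matrix and let [B] and [N]
    be the 0-1 matrices of the relations [w - v \in M] and [w + v \in M].  The
    three adjacency matrices are then

      [G_R : J - B],   [G_R^+ : J - N],   [complement of G_R : B - 1].

    The span of [1], [B], [N] and [J] is a commutative algebra (for instance
    [N * N = m B] and [B * J = m J]), and it is split by four orthogonal
    idempotents: the projections onto the constant functions; onto the
    functions of sum zero on [R / M] that are even, respectively odd, under
    [v |-> - v]; and onto the functions whose sum on every coset of [M] is
    zero.  The rank of an idempotent being its trace, all three spectra can be
    read off ([char_poly_spectral_resolution], [coset_algebra_resolution],
    [local_spectrumP]):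

    - [G_R] has eigenvalues [n - m], once, [- m], with multiplicity [n / m - 1],
      and [0] otherwise;
    - [G_R^+] has the same ones, except that [- m] becomes [+ m] on the odd
      functions, which form a nonzero space when [n] is odd, because then [2]
      is a unit and [v |-> - v] fixes only the zero coset;
    - the complement has eigenvalues [m - 1], and [- 1] with multiplicity
      [n - n / m].

    Hence [G_R] and [G_R^+] both have energy [2 (n - m)], and the complement
    has energy [2 (n - n / m)], which is equal to the former exactly when
    [n = m ^ 2].  An eigenvalue owned by a single graph of the pair ([m], or
    [- m] for the complement) excludes isospectrality.  Finally the only
    nontrivial constraint for [G_R] and [G_R^+] to be Ramanujan is
    [m <= 2 sqrt (n - m - 1)] unless [m = n - m], and squaring it gives
    [(m + 2) ^ 2 <= 4 n], which is the inequality of [cond_ii]; when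
    [n] is odd, so is its divisor [m], and the cases [m = 2] and
    [n = 2 m] do not occur. *)

Set Implicit Arguments.
Unset Strict Implicit.
Unset Printing Implicit Defensive.

Import Order.TTheory GRing.Theory Num.Theory.

Local Open Scope ring_scope.

(** * Spectra from orthogonal idempotents *)

(** Both sides are the determinant of the block matrix with rows [(1, - U)] and
    [(V, 1)], which block elimination computes in two ways. *)
Lemma det_1D_mulmxC (R : comNzRingType) m n (U : 'M[R]_(m, n)) (V : 'M_(n, m)) :
  \det (1%:M + U *m V) = \det (1%:M + V *m U).
Proof.
transitivity (\det (block_mx 1%:M (- U) V 1%:M)).
  have -> : block_mx 1%:M (- U) V 1%:M =
      block_mx 1%:M (- U) 0 1%:M *m block_mx (1%:M + U *m V) 0 V 1%:M.
    rewrite mulmx_block !(mul1mx, mul0mx, mulmx0, mulmx1, add0r).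
    by rewrite mulNmx addrK.
  by rewrite det_mulmx det_ublock det_lblock !det1 !mul1r mulr1.
have -> : block_mx 1%:M (- U) V 1%:M =
    block_mx 1%:M 0 V 1%:M *m block_mx 1%:M (- U) 0 (1%:M + V *m U).
  rewrite mulmx_block !(mul1mx, mul0mx, mulmx0, mulmx1, addr0).
  by rewrite mulmxN addrCA addNr addr0.
by rewrite det_mulmx det_ublock det_lblock !det1 !mul1r.
Qed.

Section Idempotents.

Variable F : fieldType.

(** Cancelling the outer factors of the rank factorization [E = C * D] in
    [C * D * C * D = C * D] leaves [D * C = 1]: up to the order of the factors, an
    idempotent is an identity matrix of size its rank.  Its trace and the
    determinant of [1 + d E] follow. *)
Lemma idem_row_col_base n (E : 'M[F]_n) :
  E *m E = E -> row_base E *m col_base E = 1%:M.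
Proof.
have cancel_outer k (C : 'M[F]_(n, k)) (D : 'M_(k, n)) C' D' :
    C' *m C = 1%:M -> D *m D' = 1%:M -> C *m D *m (C *m D) = C *m D ->
    D *m C = 1%:M.
  move=> C'C DD' /(congr1 (fun B => C' *m B *m D')).
  by rewrite !mulmxA C'C !mul1mx -!mulmxA DD' mulmx1.
move=> idemE; have [C' C'C] := row_fullP (col_base_full E).
have [D' DD'] := row_freeP (row_base_free E).
by apply: cancel_outer C'C DD' _; rewrite mulmx_base.
Qed.

Lemma mxtrace_idem n (E : 'M[F]_n) : E *m E = E -> \tr E = (\rank E)%:R.
Proof.
move=> /idem_row_col_base RC.
by rewrite -[E in LHS]mulmx_base mxtrace_mulC RC mxtrace1.
Qed.

Lemma det_1D_scale_idem n (E : 'M[F]_n) (d : {poly F}) : E *m E = E ->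
  \det (1%:M + d *: map_mx polyC E) = (1 + d) ^+ \rank E.
Proof.
move=> /idem_row_col_base RC.
rewrite -[E in LHS]mulmx_base map_mxM scalemxAl det_1D_mulmxC -scalemxAr -map_mxM.
by rewrite RC map_mx1 scalemx1 -raddfD /= det_scalar.
Qed.

(** [A] acts as the scalar [p.1] on the image of [p.2].  The idempotents form a
    list rather than a set of eigenprojections: the same scalar may occur
    several times, and an idempotent may be zero. *)
Definition spectral_resolution n (A : 'M[F]_n) (s : seq (F * 'M[F]_n)) : Prop :=
  [/\ A = \sum_(p <- s) p.1 *: p.2,
      \sum_(p <- s) p.2 = 1%:M,
      all (fun p => p.2 *m p.2 == p.2) s &
      pairwise (fun p q => p.2 *m q.2 == 0) s].

(** Orthogonality factors ['X - A = 1 + \sum_p ('X - p.1 - 1) p.2] as the product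
    of the matrices [1 + ('X - p.1 - 1) p.2]. *)
Lemma char_poly_spectral_resolution n (A : 'M[F]_n) s :
  spectral_resolution A s ->
  char_poly A = \prod_(p <- s) ('X - p.1%:P) ^+ \rank p.2.
Proof.
move=> [-> sum1 idem_s orth_s].
pose d (p : F * 'M[F]_n) : {poly F} := 'X - p.1%:P - 1.
have -> : char_poly (\sum_(p <- s) p.1 *: p.2) =
    \det (1%:M + \sum_(p <- s) d p *: map_mx polyC p.2).
  congr (\det _).
  transitivity (\sum_(p <- s) ('X - p.1%:P) *: map_mx polyC p.2).
    rewrite /char_poly_mx -scalemx1 -(map_mx1 polyC) -sum1 !map_mx_sum.
    by rewrite scaler_sumr -sumrB; apply: eq_bigr => p _; rewrite scalerBl map_mxZ.
  rewrite -(map_mx1 polyC) -sum1 map_mx_sum -big_split /=.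
  by apply: eq_bigr => p _; rewrite -[X in _ = X + _]scale1r -scalerDl [1 + _]addrC subrK.
elim: s idem_s orth_s {sum1} => [|p s IHs] /=.
  by rewrite !big_nil addr0 det1.
move=> /andP[/eqP idem_p idem_s] /andP[/allP orth_p orth_s].
have dE : 'X - p.1%:P = 1 + d p by rewrite [1 + _]addrC subrK.
rewrite !big_cons -IHs // dE -det_1D_scale_idem // -det_mulmx; congr (\det _).
have pS0 : map_mx polyC p.2 *m (\sum_(q <- s) d q *: map_mx polyC q.2) = 0.
  rewrite mulmx_sumr big1_seq // => q /andP[_ /orth_p/eqP pq0].
  by rewrite -scalemxAr -map_mxM pq0 map_mx0 scaler0.
by rewrite mulmxDl mul1mx mulmxDr mulmx1 -scalemxAl pS0 scaler0 addr0 addrA addrAC.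
Qed.
End Idempotents.

Lemma perm_spectrum_resolution (T : finType) (e : rel T) s :
  spectral_resolution (adjacency_mx e) s ->
  perm_eq (spectrum e) (flatten [seq nseq (\rank p.2) p.1 | p <- s]).
Proof.
move=> res_s; apply: prod_XsubC_eq.
rewrite /spectrum; case: closed_field_poly_normal => r /=.
rewrite (monicP (char_poly_monic _)) scale1r => <-.
rewrite (char_poly_spectral_resolution res_s) big_flatten big_map.
by apply: eq_bigr => p _; rewrite big_nseq iter_mulr_1.
Qed.

Lemma energy_resolution (T : finType) (e : rel T) s :
  spectral_resolution (adjacency_mx e) s ->
  energy e = \sum_(p <- s) `|p.1| * \tr p.2.
Proof.
move=> res_s; rewrite /energy (perm_big _ (perm_spectrum_resolution res_s)) /=.
rewrite big_flatten big_map; case: res_s => _ _ /allP idem_s _.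
apply: eq_big_seq => p /idem_s/eqP/mxtrace_idem->.
by rewrite big_nseq iter_addr_0 mulr_natr.
Qed.

Lemma mem_spectrum_resolution (T : finType) (e : rel T) s x :
  spectral_resolution (adjacency_mx e) s ->
  (x \in spectrum e) = has (fun p => (p.1 == x) && (\tr p.2 != 0)) s.
Proof.
move=> res_s; rewrite (perm_mem (perm_spectrum_resolution res_s)).
case: res_s => _ _ /allP idem_s _; apply/flatten_mapP/hasP => -[p sp] Hp.
  exists p => //; move: Hp; rewrite mem_nseq => /andP[rk_p /eqP->].
  by rewrite eqxx (mxtrace_idem (eqP (idem_s p sp))) pnatr_eq0 -lt0n.
exists p => //; case/andP: Hp => /eqP<-; rewrite mem_nseq eqxx andbT.
by rewrite (mxtrace_idem (eqP (idem_s p sp))) pnatr_eq0 -lt0n.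
Qed.

(** * The Ramanujan bound *)

Lemma le_2sqrtC (a b : nat) : (0 < b)%N ->
  (a%:R <= 2 * sqrtC (b%:R - 1) :> algC) = (a ^ 2 <= 4 * b.-1)%N.
Proof.
case: b => // b _; have -> : b.+1%:R - 1 = b%:R :> algC by rewrite -natr1 addrK.
rewrite -(@ler_pXn2r _ 2) ?nnegrE ?mulr_ge0 ?sqrtC_ge0 ?ler0n //.
by rewrite exprMn sqrtCK -!natrX -natrM ler_nat.
Qed.

Lemma regular_unique (T : finType) (e : rel T) (v : T) d d' :
  regular d e -> regular d' e -> d = d'.
Proof. by move=> /(_ v)<- /(_ v). Qed.

(** A graph whose eigenvalues have modulus the degree [d], a single other value
    [a] or zero meets the bound through [a] alone; the value [a = d] is the one
    excluded from it. *)
Lemma ramanujan_uniformP (T : finType) (e : rel T) (v : T) d a :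
  (0 < d)%N -> regular d e ->
  (forall x, x \in spectrum e -> [\/ `|x| = d%:R, `|x| = a%:R | `|x| = 0]) ->
  (exists2 x, x \in spectrum e & `|x| = a%:R) ->
  ramanujan e <-> (a = d \/ (a ^ 2 <= 4 * d.-1)%N).
Proof.
move=> d0 reg_e spec_e [y ey ya]; split.
  case=> d' /(regular_unique v reg_e) <- /(_ _ ey); rewrite ya eqr_nat.
  by case: eqVneq => [->|_ /(_ isT)]; [left | rewrite le_2sqrtC //; right].
move=> ad; exists d => // x /spec_e[->|->|->]; first by rewrite eqxx.
  by rewrite eqr_nat le_2sqrtC //; case: ad => [->|//]; rewrite eqxx.
by move=> _; rewrite mulr_ge0 // sqrtC_ge0 subr_ge0 ler1n.
Qed.

Lemma cond_iiE (r m : nat) :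
  cond_ii r m <-> ((m + 2) ^ 2 <= 4 * r)%N /\ m <> 2%N.
Proof.
suff -> : ((m + 2) ^ 2 <= 4 * r)%N = ((m%:R / 2 + 1) ^+ 2 <= r%:R :> rat) by [].
by rewrite -(ler_nat rat) natrX natrM natrD; apply/idP/idP; lra.
Qed.

(** * Adjacency matrices of relations *)

Lemma sum_enum_val (T : finType) (F : T -> algC) :
  \sum_x F x = \sum_(i < #|T|) F (enum_val i).
Proof. by rewrite (reindex _ (onW_bij _ (@enum_val_bij T))). Qed.

Lemma adjacency_mxM (T : finType) (e1 e2 : rel T) i j :
  (adjacency_mx e1 *m adjacency_mx e2) i j =
    #|[set z | e1 (enum_val i) z && e2 z (enum_val j)]|%:R.
Proof.
rewrite mxE -sum1_card natr_sum [RHS]big_mkcond [RHS]sum_enum_val /=.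
by apply: eq_bigr => k _; rewrite !mxE inE -natrM mulnb; case: (_ && _).
Qed.

Lemma adjacency_mx1 (T : finType) : adjacency_mx (fun _ _ : T => true) = const_mx 1.
Proof. by apply/matrixP => i j; rewrite !mxE. Qed.

Lemma mxtrace_adjacency (T : finType) (e : rel T) :
  \tr (adjacency_mx e) = #|[set v | e v v]|%:R.
Proof.
rewrite /mxtrace -sum1_card natr_sum [RHS]big_mkcond [RHS]sum_enum_val /=.
by apply: eq_bigr => k _; rewrite !mxE inE; case: (e _ _).
Qed.

(** * The algebra spanned by the coset matrices *)

Section CosetAlgebra.

Variables (F : fieldType) (n : nat) (J B N : 'M[F]_n) (r k : F).
Hypotheses (r_neq0 : r != 0) (k2_neq0 : 2 * k != 0).
Hypotheses (JJ : J *m J = r *: J) (JB : J *m B = k *: J) (BJ : B *m J = k *: J).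
Hypotheses (JN : J *m N = k *: J) (NJ : N *m J = k *: J).
Hypotheses (BB : B *m B = k *: B) (NN : N *m N = k *: B).
Hypotheses (BN : B *m N = k *: N) (NB : N *m B = k *: N).

(** Projections onto the constants, onto the even and the odd functions of sum
    zero on the cosets, and onto the functions of sum zero on each coset. *)
Definition coset_idempotents : seq 'M[F]_n :=
  [:: r^-1 *: J; (2 * k)^-1 *: (B + N) - r^-1 *: J;
      (2 * k)^-1 *: (B - N); 1%:M - k^-1 *: B].

(** The coefficients on the left are those of [J], [B], [N] and [1] in
    [a E0 + b E1 + c E2 + d E3], where [E0], ..., [E3] are the idempotents. *)
Lemma coset_algebra_resolution a b c d :
  spectral_resolution
    (((a - b) / r) *: J + ((b + c - 2 * d) / (2 * k)) *: B
       + ((b - c) / (2 * k)) *: N + d%:M)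
    (zip [:: a; b; c; d] coset_idempotents).
Proof.
have [two0 k0] : 2 != 0 :> F /\ k != 0.
  by move: k2_neq0; rewrite mulf_eq0 negb_or => /andP[].
have mulE := (mulmxBl, mulmxBr, mulmxDl, mulmxDr, mul1mx, mulmx1,
  =^~ scalemxAl, =^~ scalemxAr, (JJ, JB, JN, BJ, NJ), (BB, BN, NB, NN)).
split.
- rewrite /= !big_cons big_nil /=; apply/matrixP => i j; rewrite !mxE.
  by case: (i == j); rewrite ?mulr1n ?mulr0n; field; rewrite r_neq0 k0 two0.
- rewrite /= !big_cons big_nil /=; apply/matrixP => i j; rewrite !mxE.
  by case: (i == j); rewrite ?mulr1n ?mulr0n; field; rewrite r_neq0 k0 two0.
- rewrite /= !mulE andbT.
  apply/and4P; split; apply/eqP/matrixP => i j; rewrite !mxE;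
    by case: (i == j); rewrite ?mulr1n ?mulr0n; field; rewrite ?r_neq0 ?k0 ?two0.
rewrite /= !mulE !andbT -!andbA.
repeat (apply/andP; split); apply/eqP/matrixP => i j; rewrite !mxE;
  by case: (i == j); rewrite ?mulr1n ?mulr0n; field; rewrite ?r_neq0 ?k0 ?two0.
Qed.

End CosetAlgebra.

(** * Nonunits and cosets in a local ring *)

Section LocalRing.

Variables (R : finComUnitRingType) (M : {set R}).
Hypothesis localM : local_ring M.
Local Notation n := #|R|.
Local Notation m := #|M|.
Local Notation r := (n%:R : algC).
Local Notation k := (m%:R : algC).
Local Notation J := (const_mx 1 : 'M[algC]_n).
Local Notation G := (@unitary_graph R).
Local Notation Gsum := (@unitary_sum_graph R).
Local Notation Gc := (complement_graph (@unitary_graph R)).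

(** By finiteness a proper ideal lies in a maximal one, and [M] is the only
    maximal ideal.  Being an ideal is first made decidable, so that a maximal
    set with this property can be picked. *)
Lemma proper_ideal_sub_local (I : {set R}) : idealr_closed I -> I \subset M.
Proof.
pose idealb (J : {set R}) := [&& 0 \in J, 1 \notin J &
  [forall a, forall u in J, forall v in J, a * u + v \in J]].
have idealP (J : {set R}) : reflect (idealr_closed J) (idealb J).
  apply: (iffP and3P) => -[J0 J1 JD]; split=> //.
    by move=> a u v Ju Jv; have/forallP/(_ a)/forall_inP/(_ u Ju)/forall_inP := JD; apply.
  by apply/forallP => a; apply/forall_inP => u Ju; apply/forall_inP => v; apply: JD.
move=> /idealP /maxset_exists[K /maxsetP[/idealP idK maxK] subIK].
rewrite -(localM.2 K) //; split=> // J /idealP idJ; exact: maxK.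
Qed.

Lemma local_ideal_closed : idealr_closed M. Proof. exact: localM.1.1. Qed.

Lemma local_unitE (x : R) : (x \is a GRing.unit) = (x \notin M).
Proof.
have [M0 M1 MD] := local_ideal_closed; apply/idP/idP => [Ux | ].
  by apply: contra M1 => Mx; rewrite -(mulVr Ux) -[_ * _]addr0 MD.
apply: contraR => nUx.
(* The principal ideal of a nonunit is proper, hence contained in M. *)
suff /proper_ideal_sub_local /subsetP : idealr_closed [set a * x | a in [set: R]].
  by apply; apply/imsetP; exists 1; rewrite ?mul1r.
split.
- by apply/imsetP; exists 0; rewrite ?mul0r.
- apply: contra nUx => /imsetP[a _ ax]; apply/unitrP; exists a.
  by rewrite [x * a]mulrC -ax.
move=> a _ _ /imsetP[b _ ->] /imsetP[c _ ->]; apply/imsetP.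
by exists (a * b + c); rewrite ?mulrDl ?mulrA.
Qed.

Lemma local_ideal0 : 0 \in M. Proof. by case: local_ideal_closed. Qed.

Lemma local_idealB x y : x \in M -> y \in M -> x - y \in M.
Proof. by case: (idealr_closedB local_ideal_closed) => _; apply. Qed.

Lemma local_idealN x : (- x \in M) = (x \in M).
Proof.
by apply/idP/idP=> /(local_idealB local_ideal0); rewrite sub0r ?opprK.
Qed.

Lemma local_idealMl a x : x \in M -> a * x \in M.
Proof.
have [M0 _ MD] := local_ideal_closed.
by move=> Mx; rewrite -[_ * _]addr0 MD.
Qed.

Lemma local_idealDr x y : x \in M -> (x + y \in M) = (y \in M).
Proof.
move=> Mx; apply/idP/idP => My.
  by have := local_idealB My Mx; rewrite addrC addKr.
by have := local_idealB My (local_idealB local_ideal0 Mx); rewrite sub0r opprK addrC.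
Qed.

Lemma card_coset (a : R) : #|[set z | z - a \in M]| = #|M|.
Proof.
rewrite -(card_imset (mem M) (addrI a)); congr #|pred_of_set _|.
apply/setP => z; rewrite inE; apply/idP/imsetP => [Mz | [u Mu ->]].
  by exists (z - a); rewrite // addrC subrK.
by rewrite addrC addKr.
Qed.

(** [M] and its translate [1 + M] are disjoint. *)
Lemma card_double_ideal : (#|M| * 2 <= #|R|)%N.
Proof.
have [M0 M1 _] := local_ideal_closed.
have dis : [disjoint M & [set z | z - 1 \in M]].
  rewrite -setI_eq0; apply/eqP/setP => z; rewrite !inE.
  apply/andP => -[Mz /(local_idealB Mz)].
  by rewrite opprB addrC subrK (negPf M1).
rewrite muln2 -addnn -[X in (_ + X)%N](card_coset 1) -cardsUI.
by rewrite (disjoint_setI0 dis) cards0 addn0 max_card.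
Qed.

(** The parameter [s] takes the values [1] and [-1], which give the relations
    [w - v \in M] and [w + v \in M]; with [s] left free a single product formula
    covers both. *)
Definition coset_mx (s : R) : 'M[algC]_n :=
  adjacency_mx (fun v w => w - s * v \in M).

(** A path [v, z, w] has [z] in [s v + M], and then [w - t z] and [w - t s v]
    agree modulo [M]: either all [m] elements of that coset are on a path, or
    none is. *)
Lemma coset_mxM s t : coset_mx s *m coset_mx t = m%:R *: coset_mx (t * s).
Proof.
apply/matrixP => i j; rewrite adjacency_mxM !mxE.
set v := enum_val i; set w := enum_val j.
have eqM z : z - s * v \in M -> (w - t * z \in M) = (w - t * s * v \in M).
  move=> /(local_idealMl t) /local_idealDr <-; congr (_ \in M); ring.
case: (boolP (w - _ \in M)) => Mw; last first.
  rewrite mulr0 -[0]/(0%:R) -(cards0 R); congr (_%:R); apply: eq_card => z.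
  by rewrite !inE; apply/andP => -[/eqM->]; apply/negP.
rewrite mulr1 -(card_coset (s * v)); congr (_%:R); apply: eq_card => z.
by rewrite !inE; case: (boolP (z - _ \in M)) => // /eqM->.
Qed.

Lemma coset_mx_const s : coset_mx s *m J = m%:R *: J.
Proof.
apply/matrixP => i j; rewrite -adjacency_mx1 adjacency_mxM !mxE mulr1.
rewrite -(card_coset (s * enum_val i)); congr (_%:R); apply: eq_card => z.
by rewrite !inE andbT.
Qed.

(** As [s] is its own inverse, [w - s z] lies in [M] exactly when [z] lies in the
    coset of [s w]. *)
Lemma const_coset_mx s : s * s = 1 -> J *m coset_mx s = m%:R *: J.
Proof.
move=> ss; apply/matrixP => i j; rewrite -adjacency_mx1 adjacency_mxM !mxE mulr1.
rewrite -(card_coset (s * enum_val j)); congr (_%:R); apply: eq_card.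
have Ms x : s * x \in M -> x \in M.
  by move=> /(local_idealMl s); rewrite mulrA ss mul1r.
move=> z; rewrite !inE /=; apply/idP/idP => H.
  by rewrite -local_idealN; apply: Ms; rewrite opprB mulrBr mulrA ss mul1r.
by rewrite -local_idealN; apply: Ms; rewrite opprB mulrBr mulrA ss mul1r.
Qed.

Lemma const_mx_sqr : J *m J = n%:R *: J.
Proof.
apply/matrixP => i j; rewrite -adjacency_mx1 adjacency_mxM !mxE mulr1.
by rewrite -cardsT; congr (_%:R); apply: eq_card => z; rewrite !inE.
Qed.

Lemma mxtrace_const : \tr J = n%:R.
Proof. by rewrite -adjacency_mx1 mxtrace_adjacency -cardsT. Qed.

Lemma mxtrace_coset1 : \tr (coset_mx 1) = n%:R.
Proof.
rewrite mxtrace_adjacency -cardsT; congr (_%:R); apply: eq_card => z.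
by rewrite !inE mul1r subrr local_ideal0.
Qed.

(** The diagonal entries count the [v] such that [2 v] lies in [M]. *)
Lemma mxtrace_cosetN1 : 2 \is a @GRing.unit R -> \tr (coset_mx (-1)) = m%:R.
Proof.
move=> U2; rewrite mxtrace_adjacency; congr (_%:R); apply: eq_card => z.
rewrite !inE mulN1r opprK -mulr2n -mulr_natl.
apply/idP/idP => [/(local_idealMl 2^-1)|]; last exact: local_idealMl.
by rewrite mulrA mulVr ?mul1r.
Qed.

Lemma adjacency_unitary : adjacency_mx (@unitary_graph R) = J - coset_mx 1.
Proof.
apply/matrixP => i j; rewrite !mxE /unitary_graph local_unitE mul1r.
by case: (_ \in M); rewrite ?subrr ?subr0.
Qed.

Lemma adjacency_unitary_sum :
  adjacency_mx (@unitary_sum_graph R) = J - coset_mx (-1).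
Proof.
apply/matrixP => i j; rewrite !mxE /unitary_sum_graph local_unitE.
by rewrite mulN1r opprK [enum_val j + _]addrC; case: (_ \in M); rewrite ?subrr ?subr0.
Qed.

Lemma adjacency_complement :
  adjacency_mx (complement_graph (@unitary_graph R)) = coset_mx 1 - 1%:M.
Proof.
apply/matrixP => i j; rewrite !mxE /complement_graph /unitary_graph local_unitE.
rewrite mul1r negbK (inj_eq enum_val_inj); case: eqVneq => [->|_] /=.
  by rewrite subrr local_ideal0 subrr.
by rewrite subr0.
Qed.

Lemma regular_unitary : regular (n - m) (@unitary_graph R).
Proof.
move=> v; rewrite -(card_coset v) -cardsT -cardsDS ?subsetT //.
by apply: eq_card => w; rewrite !inE /unitary_graph local_unitE andbT.
Qed.

Lemma regular_unitary_sum : regular (n - m) (@unitary_sum_graph R).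
Proof.
move=> v; rewrite -(card_coset (- v)) -cardsT -cardsDS ?subsetT //.
apply: eq_card => w.
by rewrite !inE /unitary_sum_graph local_unitE andbT opprK addrC.
Qed.

Lemma regular_complement : regular m.-1 (complement_graph (@unitary_graph R)).
Proof.
move=> v; rewrite -(card_coset v) [in RHS](cardsD1 v) inE subrr local_ideal0 /=.
apply: eq_card => w.
by rewrite !inE /complement_graph /unitary_graph local_unitE negbK eq_sym.
Qed.

(** Translating by [1] the sum of all elements of [R] shows that [n%:R = 0] in
    [R]; for odd [n] this says that [2] has inverse [- (n - 1) / 2]. *)
Lemma odd_card_unit2 : odd n -> 2 \is a @GRing.unit R.
Proof.
move=> odd_n; have n0 : n%:R = 0 :> R.
  apply: (@addrI _ (\sum_(x : R) x)); rewrite addr0 -cardsT -sumr_const.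
  rewrite big_set big_mkcond /= -big_split /=.
  by rewrite [RHS](reindex_inj (addIr 1)).
apply/unitrP; exists (- (n./2)%:R); rewrite [2 * _]mulrC mulNr.
suff -> : - ((n./2)%:R * 2) = 1 :> R by [].
apply/eqP; rewrite eqr_oppLR -addr_eq0 addrC; apply/eqP; rewrite -[2]/(2%:R) -natrM muln2.
by rewrite -n0 -[in X in _ = X](odd_double_half n) odd_n natrD.
Qed.


(** * Spectra and energies of the three graphs *)

Lemma card_ideal_gt0 : (0 < m)%N.
Proof. by apply/card_gt0P; exists 0; apply: local_ideal0. Qed.

Lemma card_ideal_neq0 : k != 0.
Proof. by rewrite pnatr_eq0 -lt0n card_ideal_gt0. Qed.

Lemma card_ring_neq0 : r != 0.
Proof. by rewrite pnatr_eq0 -lt0n; apply/card_gt0P; exists 0. Qed.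

(** The idempotent [B / m] has trace [n / m], which is its rank, hence a natural
    number. *)
Lemma card_ideal_dvd : (m %| n)%N.
Proof.
have k0 := card_ideal_neq0.
have idemE : (k^-1 *: coset_mx 1) *m (k^-1 *: coset_mx 1) = k^-1 *: coset_mx 1.
  rewrite -scalemxAl -scalemxAr coset_mxM // mulr1 !scalerA.
  by congr (_ *: _); field.
have := mxtrace_idem idemE; rewrite mxtraceZ mxtrace_coset1 //.
move=> /(canRL (mulKf (invr_neq0 k0))); rewrite invrK -natrM => /eqP.
by rewrite eqr_nat => /eqP->; apply: dvdn_mulr.
Qed.

Local Notation B := (coset_mx 1).
Local Notation N := (coset_mx (-1)).

Lemma local_resolution (e : rel R) a b c d :
  adjacency_mx e = ((a - b) / r) *: J + ((b + c - 2 * d) / (2 * k)) *: B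
       + ((b - c) / (2 * k)) *: N + d%:M ->
  spectral_resolution (adjacency_mx e)
    (zip [:: a; b; c; d] (coset_idempotents J B N r k)).
Proof.
move=> ->; apply: coset_algebra_resolution.
- exact: card_ring_neq0.
- by rewrite mulf_neq0 ?card_ideal_neq0 // pnatr_eq0.
- exact: const_mx_sqr.
- by apply: const_coset_mx; rewrite ?mulr1.
- exact: coset_mx_const.
- by apply: const_coset_mx; rewrite ?mulrNN ?mulr1.
- exact: coset_mx_const.
- by rewrite coset_mxM ?mulr1.
- by rewrite coset_mxM ?mulrNN ?mulr1.
- by rewrite coset_mxM ?mulr1.
- by rewrite coset_mxM ?mul1r.
Qed.

(** The ranks of the last three coset idempotents.  The trace of [N] is kept as
    it is, since it depends on whether [2] is a unit; only [mult_even +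
    mult_odd] matters unless the eigenvalues on the even and odd functions
    differ. *)
Definition mult_even : algC := (r + \tr N) / (2 * k) - 1.
Definition mult_odd : algC := (r - \tr N) / (2 * k).
Definition mult_fiber : algC := r - r / k.

Lemma mult_even_odd : mult_even + mult_odd = r / k - 1.
Proof. by rewrite /mult_even /mult_odd; field; rewrite card_ideal_neq0. Qed.

Lemma trace_coset_idempotents :
  map mxtrace (coset_idempotents J B N r k) = [:: 1; mult_even; mult_odd; mult_fiber].
Proof.
rewrite /= !(linearB, linearD, linearZ) /= mxtrace_const mxtrace_coset1 // mxtrace1.
by rewrite mulVf ?card_ring_neq0 // ![_^-1 * _]mulrC.
Qed.

(** A scalar is an eigenvalue only if one of its idempotents is nonzero, that is,
    has nonzero trace; the constants always form a line. *)
Lemma local_spectrumP (e : rel R) a b c d :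
  adjacency_mx e = ((a - b) / r) *: J + ((b + c - 2 * d) / (2 * k)) *: B
       + ((b - c) / (2 * k)) *: N + d%:M ->
  energy e = `|a| + `|b| * mult_even + `|c| * mult_odd + `|d| * mult_fiber /\
  spectrum e =i [pred x | [|| a == x, (b == x) && (mult_even != 0),
    (c == x) && (mult_odd != 0) | (d == x) && (mult_fiber != 0)]].
Proof.
move=> /local_resolution res_e; have [t0 t1 t2 t3] := trace_coset_idempotents.
split=> [|x].
  rewrite (energy_resolution res_e) /= !big_cons big_nil /= t0 t1 t2 t3.
  by rewrite mulr1 addr0 !addrA.
by rewrite (mem_spectrum_resolution x res_e) /= t0 t1 t2 t3 oner_eq0 andbT orbF.
Qed.

Lemma card_units_gt0 : (0 < n - m)%N.
Proof. have := card_double_ideal; have := card_ideal_gt0; lia. Qed.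

Lemma degreeE : (n - m)%:R = r - k.
Proof. by rewrite natrB // ltnW // -subn_gt0 card_units_gt0. Qed.

Lemma two_neq0 : 2 != 0 :> algC. Proof. by rewrite pnatr_eq0. Qed.

Lemma ring_minus_ideal_neq0 : r - k != 0.
Proof. by rewrite -degreeE pnatr_eq0 -lt0n card_units_gt0. Qed.

Lemma mult_even_odd_neq0 : mult_even + mult_odd != 0.
Proof.
rewrite mult_even_odd subr_eq0; apply: contra ring_minus_ideal_neq0 => /eqP rk.
by rewrite -[X in X - _](divfK card_ideal_neq0) rk mul1r subrr.
Qed.

Lemma norm_degree : `|r - k| = r - k.
Proof. by rewrite -degreeE normr_nat. Qed.

(** The even and odd functions share the eigenvalue [- m], and at least one of
    the two spaces is nonzero. *)
Lemma unitary_spectrumP :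
  energy G = 2 * (r - k) /\
  spectrum G =i [pred x | [|| r - k == x, - k == x | (0 == x) && (mult_fiber != 0)]].
Proof.
have r0 := card_ring_neq0; have k0 := card_ideal_neq0.
have [|-> spE] := @local_spectrumP G (r - k) (- k) (- k) 0.
  rewrite adjacency_unitary; apply/matrixP => i j; rewrite !mxE mul0rn.
  by field; rewrite r0 k0.
split=> [|x].
  rewrite norm_degree normrN normr0 normr_nat mul0r addr0 -addrA -mulrDr mult_even_odd.
  by field; rewrite k0.
rewrite spE !inE; congr (_ || _); rewrite orbA -andb_orr -negb_and.
suff -> : ~~ ((mult_even == 0) && (mult_odd == 0)) by rewrite andbT.
by apply: contra mult_even_odd_neq0 => /andP[/eqP-> /eqP->]; rewrite addr0.
Qed.

(** On the even functions [N] acts as [B], on the odd ones as [- B], so only the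
    sign of some eigenvalues differs from the unitary graph. *)
Lemma unitary_sum_spectrumP :
  energy Gsum = 2 * (r - k) /\
  spectrum Gsum =i [pred x | [|| r - k == x, (- k == x) && (mult_even != 0),
     (k == x) && (mult_odd != 0) | (0 == x) && (mult_fiber != 0)]].
Proof.
have r0 := card_ring_neq0; have k0 := card_ideal_neq0.
have [|-> spE] := @local_spectrumP Gsum (r - k) (- k) k 0.
  rewrite adjacency_unitary_sum; apply/matrixP => i j; rewrite !mxE mul0rn.
  by field; rewrite r0 k0.
split=> //; rewrite norm_degree normrN normr0 normr_nat mul0r addr0 -addrA -mulrDr.
by rewrite mult_even_odd; field; rewrite k0.
Qed.

Lemma mult_odd_neq0 : odd n -> mult_odd != 0.
Proof.
move=> odd_n; rewrite /mult_odd mxtrace_cosetN1 ?odd_card_unit2 //.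
rewrite mulf_neq0 ?ring_minus_ideal_neq0 // invr_neq0 ?mulf_neq0 ?two_neq0 //.
exact: card_ideal_neq0.
Qed.

Lemma complement_spectrumP :
  energy Gc = 2 * mult_fiber /\
  spectrum Gc =i [pred x | (k - 1 == x) || (-1 == x) && (mult_fiber != 0)].
Proof.
have r0 := card_ring_neq0; have k0 := card_ideal_neq0.
have [|-> spE] := @local_spectrumP Gc (k - 1) (k - 1) (k - 1) (-1).
  rewrite adjacency_complement; apply/matrixP => i j; rewrite !mxE.
  by case: (i == j); rewrite ?mulr1n ?mulr0n; field; rewrite r0 k0.
split=> [|x].
  have -> : `|k - 1| = k - 1 by rewrite ger0_norm ?subr_ge0 ?ler1n ?card_ideal_gt0.
  have -> : mult_odd = r / k - 1 - mult_even by rewrite -mult_even_odd addrC addKr.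
  by rewrite normrN1 mul1r /mult_fiber; field; rewrite k0.
by rewrite spE !inE; case: eqP.
Qed.

Lemma mult_fiber_neq0 : (mult_fiber != 0) = (m != 1%N).
Proof.
rewrite /mult_fiber subr_eq0; congr (~~ _).
rewrite -(inj_eq (mulIf card_ideal_neq0)) divfK ?card_ideal_neq0 //.
by rewrite -[X in _ == X]mulr1 (inj_eq (mulfI card_ring_neq0)) pnatr_eq1.
Qed.

Lemma energy_complementE : energy G = energy Gc <-> n = (m ^ 2)%N.
Proof.
have r0 := card_ring_neq0; have k0 := card_ideal_neq0.
have [-> _] := unitary_spectrumP; have [-> _] := complement_spectrumP.
have nE : n = (m ^ 2)%N <-> r = k * k.
  by rewrite -natrM mulnn; split=> [<- // | /eqP]; rewrite eqr_nat => /eqP.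
rewrite nE /mult_fiber; split=> [/(mulfI two_neq0)/addrI/oppr_inj rk | ->].
  by rewrite [X in X * k]rk divfK.
by rewrite mulfK.
Qed.

Lemma odd_card_ideal : odd n -> odd m.
Proof. by have /dvdnP[q ->] := card_ideal_dvd; rewrite oddM => /andP[]. Qed.

(** * Ramanujan property and isospectrality *)

(** With degree [d = n - m], the bound [m ^ 2 <= 4 (d - 1)] is
    [(m + 2) ^ 2 <= 4 n]. *)
Lemma ramanujan_local (e : rel R) :
  regular (n - m) e ->
  {subset spectrum e <= [:: r - k; - k; k; 0]} ->
  (exists2 x, x \in spectrum e & `|x| = k) ->
  ramanujan e <-> n = (2 * m)%N \/ ((m + 2) ^ 2 <= 4 * n)%N.
Proof.
move=> reg_e spec_e ex_k.
have -> : n = (2 * m)%N \/ ((m + 2) ^ 2 <= 4 * n)%N <->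
    m = (n - m)%N \/ (m ^ 2 <= 4 * (n - m).-1)%N.
  by have lt_m_n := card_units_gt0; split=> -[H|H]; [left|right|left|right]; nia.
apply: (ramanujan_uniformP 0 card_units_gt0 reg_e) ex_k => x /spec_e.
rewrite !inE degreeE => /or4P[] /eqP->.
- by constructor 1; rewrite norm_degree.
- by constructor 2; rewrite normrN normr_nat.
- by constructor 2; rewrite normr_nat.
- by constructor 3; rewrite normr0.
Qed.

Lemma ramanujan_unitary : ramanujan G <-> n = (2 * m)%N \/ ((m + 2) ^ 2 <= 4 * n)%N.
Proof.
have [_ spE] := unitary_spectrumP; apply: ramanujan_local.
- exact: regular_unitary.
- move=> x; rewrite spE !inE.
  by case/or3P => [/eqP<-|/eqP<-|/andP[/eqP<- _]]; rewrite eqxx ?orbT.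
- by exists (- k); rewrite ?spE ?inE ?eqxx ?orbT // normrN normr_nat.
Qed.

Lemma ramanujan_unitary_sum : odd n ->
  ramanujan Gsum <-> n = (2 * m)%N \/ ((m + 2) ^ 2 <= 4 * n)%N.
Proof.
move=> odd_n; have [_ spE] := unitary_sum_spectrumP; apply: ramanujan_local.
- exact: regular_unitary_sum.
- move=> x; rewrite spE !inE.
  by case/or4P => [/eqP<-|/andP[/eqP<- _]|/andP[/eqP<- _]|/andP[/eqP<- _]];
    rewrite eqxx ?orbT.
- by exists k; rewrite ?spE ?inE ?eqxx ?mult_odd_neq0 ?orbT // normr_nat.
Qed.

(** The eigenvalue [-1] occurs only for [m > 1]; it has the modulus of the degree
    if [m = 2], and is below the bound [2 sqrt (m - 2)] if [m > 2]. *)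
Lemma ramanujan_complement : ramanujan Gc.
Proof.
have [_ spE] := complement_spectrumP; exists m.-1; first exact: regular_complement.
have kE : k - 1 = m.-1%:R by rewrite -(prednK card_ideal_gt0) -natr1 addrK.
move=> x; rewrite spE inE kE => /orP[/eqP<-|/andP[/eqP<-]].
  by rewrite normr_nat eqxx.
rewrite mult_fiber_neq0 => m1; rewrite normrN1 => m2.
have {}m2 : (1 < m.-1)%N.
  by move: m2 m1 card_ideal_gt0; rewrite eq_sym pnatr_eq1; lia.
by rewrite (le_2sqrtC 1) ?(ltnW m2) //; lia.
Qed.

(** [m] is an eigenvalue of the second graph; for the first one this would force
    [n = 2 m]. *)
Lemma not_isospectral_sum : odd n -> ~ isospectral G Gsum.
Proof.
move=> odd_n [_ /perm_mem/(_ k)].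
have [_ ->] := unitary_spectrumP; have [_ ->] := unitary_sum_spectrumP.
rewrite !inE eqxx mult_odd_neq0 // !orbT.
rewrite -degreeE eqr_nat eqr_oppLR -addr_eq0 -natrD !(eq_sym 0) !pnatr_eq0.
have := card_ideal_gt0; have := card_units_gt0; have := odd_n; lia.
Qed.

(** [- m] is an eigenvalue of the first graph.  For the complement it would be
    [m - 1], against parity, or [- 1], so that [m = 1]; but then the
    complement has no edge and only the eigenvalue [0]. *)
Lemma not_isospectral_complement : ~ isospectral G Gc.
Proof.
move=> [_ /perm_mem/(_ (- k))].
have [_ ->] := unitary_spectrumP; have [_ ->] := complement_spectrumP.
rewrite !inE eqxx orbT mult_fiber_neq0 eqr_opp [1 == _]eq_sym pnatr_eq1.
have -> : (k - 1 == - k) = (m + m == 1)%N.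
  by rewrite -(eqr_nat algC) natrD -subr_eq0 -[RHS]subr_eq0 opprK addrAC.
lia.
Qed.

End LocalRing.

Theorem theorem5p1 (R : finComUnitRingType) (M : {set R}) (r m : nat)
    (hR : local_ring M) (hr : #|R| = r) (hm : #|M| = m) :
  (odd r ->
    (equienergetic (@unitary_graph R) (@unitary_sum_graph R) /\
     ~ isospectral (@unitary_graph R) (@unitary_sum_graph R)) /\
    ((ramanujan (@unitary_graph R) /\ ramanujan (@unitary_sum_graph R)) <->
     cond_ii r m)) /\
  (((equienergetic (@unitary_graph R) (complement_graph (@unitary_graph R)) /\
     ~ isospectral (@unitary_graph R) (complement_graph (@unitary_graph R))) <->
    r = (m ^ 2)%N) /\
   ramanujan (complement_graph (@unitary_graph R)) /\
   (cond_i r m \/ cond_ii r m -> ramanujan (@unitary_graph R))).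
Proof.
subst r m; split=> [odd_r | ].
  split.
    split; last exact: not_isospectral_sum hR _.
    have [eG _] := unitary_spectrumP hR; have [eGsum _] := unitary_sum_spectrumP hR.
    by split; rewrite ?eG ?eGsum.
  rewrite cond_iiE (ramanujan_unitary hR) (ramanujan_unitary_sum hR odd_r).
  have := odd_card_ideal hR odd_r; lia.
split; last split; last by rewrite (ramanujan_unitary hR) cond_iiE; case=> [|[]]; auto.
- rewrite -(energy_complementE hR); split=> [[[]] // | eqE].
  by split; [split | exact: not_isospectral_complement hR].
- exact: ramanujan_complement hR.
Qed.
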